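(* Let $k\ge2$ be an integer and let $P_k$ be the $k$-gon. There is an isomorphism of groups $$\Gamma\mathrm{R}^-(P_k)\simeq\begin{cases}\mathrm{Sym}_k & \text{if } k \text{ is even},\\ \mathrm{Ker}(\chi) & \text{if } k\text{ is odd},\end{cases}$$ where $\chi:C_2\wr\mathrm{Sym}_k\to C_2$ denotes the canonical character.
   Context: The $k$-gon $P_k$ is the poset consisting of a minimum $F_{-1}$, a maximum $F_2$, $k$ vertices $v_1,\dots,v_k$ and $k$ edges $e_1,\dots,e_k$, with $v_i\prec e_i$ and $v_{i+1}\prec e_i$ (indices modulo $k$), and no further relations between vertices and edges. Its automorphism group (order automorphisms) is the dihedral group of order $2k$. For each edge $e_i$ there is exactly one non-trivial automorphism $\phi_i$ of $P_k$ stabilizing $e_i$ (it exchanges the two vertices of $e_i$). $\mathrm{R}(P_k)$ is the set of pairs $(F,G)$ with $F\preceq G$ and $F,G\notin\{F_{-1},F_2\}$. For an edge $H$ and an automorphism $\phi$ of $P_k$ stabilizing $H$ (rotational or not), the move $\mu_\phi$ is the permutation of $\mathrm{R}(P_k)$ given by $\mu_\phi(F,G)=(\phi(F),\phi(G))$ if $F\preceq H$ and $\mu_\phi(F,G)=(F,G)$ otherwise. The non-rotational Rubik's group $\Gamma\mathrm{R}^-(P_k)$ is the permutation group on $\mathrm{R}(P_k)$ generated by all these moves, over all edges $H$ and all such $\phi$. $C_2$ is the group of order two, $C_2\wr\mathrm{Sym}_k=C_2^k\rtimes\mathrm{Sym}_k$ with $\mathrm{Sym}_k$ permuting components, and the canonical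 character is $\chi(\gamma,\sigma)=\prod_{1\le j\le k}\gamma^j$. *)

(* Defs.v *)
From HB Require Import structures.
From mathcomp Require Import all_boot all_order all_fingroup all_algebra.

Set Implicit Arguments.
Unset Strict Implicit.
Unset Printing Implicit Defensive.

Import Order.TTheory.
Local Open Scope group_scope.

(* The faces of P_k; [Fmin] is F_{-1} and [Fmax] is F_2. *)

Inductive face (k : nat) : predArgType :=
| Fmin
| Vertex of 'I_k
| Edge of 'I_k
| Fmax.

Arguments Fmin {k}.
Arguments Vertex {k}.
Arguments Edge {k}.
Arguments Fmax {k}.

Section FaceFinite.

Variable k : nat.

Definition face_code (F : face k) : bool + ('I_k + 'I_k) :=
  match F with
  | Fmin => inl false
  | Vertex i => inr (inl i)
  | Edge i => inr (inr i)
  | Fmax => inl true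
  end.

Definition face_decode (c : bool + ('I_k + 'I_k)) : face k :=
  match c with
  | inl false => Fmin
  | inr (inl i) => Vertex i
  | inr (inr i) => Edge i
  | inl true => Fmax
  end.

Lemma face_codeK : cancel face_code face_decode.
Proof. by case. Qed.

HB.instance Definition _ := Finite.copy (face k) (can_type face_codeK).

End FaceFinite.

Section FaceOrder.

Variable k : nat.
Implicit Types F G H : face k.

(* [ordS i] is i + 1 modulo k. *)
Definition face_le F G : bool :=
  match F, G with
  | Fmin, _ => true
  | _, Fmax => true
  | Vertex i, Vertex j => i == j
  | Vertex i, Edge j => (i == j) || (i == ordS j)
  | Edge i, Edge j => i == j
  | _, _ => false
  end.

Lemma face_le_refl : reflexive face_le.
Proof. by case=> //= i; rewrite eqxx. Qed.

Lemma face_le_anti : antisymmetric face_le.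
Proof. by case=> [|i|i|] [|j|j|] //= /andP[]// /eqP->. Qed.

Lemma face_le_trans : transitive face_le.
Proof.
by case=> [|i|i|] [|j|j|] [|l|l|] //=; do ?[move=> /eqP-> | move=> ? /eqP<-].
Qed.

Fact face_display : Order.disp_t. Proof. exact: Order.Disp tt tt. Qed.

HB.instance Definition _ := Order.Le_isPOrder.Build face_display (face k)
  face_le_refl face_le_anti face_le_trans.

End FaceOrder.

Section Rubik.

Variable k : nat.
Implicit Types (F G : face k) (H : 'I_k) (phi : {perm face k}).

Definition face_aut : {set {perm face k}} :=
  [set phi : {perm face k} |
    [forall F : face k, forall G : face k,
       (phi F <= phi G)%O == (F <= G)%O]].

Definition edge_stab H : {set {perm face k}} :=
  [set phi in face_aut | phi (Edge H) == Edge H].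

Lemma face_autP phi :
  reflect (forall F G, (phi F <= phi G)%O = (F <= G)%O) (phi \in face_aut).
Proof.
rewrite inE; apply: (iffP forallP) => [h F G|h F].
  by apply/eqP; move: G; apply/forallP.
by apply/forallP=> G; rewrite h.
Qed.

Definition proper_face F : bool := (F != Fmin) && (F != Fmax).

Definition RP_pred (x : face k * face k) : bool :=
  [&& (x.1 <= x.2)%O, proper_face x.1 & proper_face x.2].

Definition RP : predArgType := {x : face k * face k | RP_pred x}.

Lemma face_aut_proper phi F :
  phi \in face_aut -> proper_face (phi F) = proper_face F.
Proof.
move=> /face_autP hphi.
have h0 : phi Fmin = Fmin.
  have : (phi Fmin <= phi (phi^-1 Fmin))%O by rewrite hphi.
  by rewrite permKV; case: (phi Fmin).
have h1 : phi Fmax = Fmax.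
  have : (phi (phi^-1 Fmax) <= phi Fmax)%O by rewrite hphi; case: (phi^-1 _).
  by rewrite permKV; case: (phi Fmax).
by rewrite /proper_face -{1}h0 -{1}h1 !(inj_eq perm_inj).
Qed.

Definition move_pair H phi (x : face k * face k) : face k * face k :=
  if (x.1 <= Edge H)%O then (phi x.1, phi x.2) else x.

Lemma move_pairP H phi (x : RP) :
  phi \in edge_stab H -> RP_pred (move_pair H phi (val x)).
Proof.
case: x => x /= Rx; rewrite inE => /andP[hphi _].
rewrite /move_pair; case: ifP => // _; rewrite /RP_pred /=.
by rewrite !face_aut_proper // (face_autP _ hphi).
Qed.

Definition move_fun H phi (hphi : phi \in edge_stab H) (x : RP) : RP :=
  Sub (move_pair H phi (val x)) (move_pairP x hphi).

Lemma move_fun_inj H phi (hphi : phi \in edge_stab H) :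
  injective (move_fun hphi).
Proof.
have [/face_autP hle /eqP hH] : phi \in face_aut /\ phi (Edge H) == Edge H.
  by apply/andP; move: hphi; rewrite inE.
have hst F : (phi F <= Edge H)%O = (F <= Edge H)%O by rewrite -{1}hH hle.
suff inj : injective (move_pair H phi).
  by move=> x y /(congr1 val) /inj /val_inj.
case=> [x1 x2] [y1 y2]; rewrite /move_pair /=.
case: ifP => hx; case: ifP => hy // [].
- by move=> /perm_inj-> /perm_inj->.
- by move=> e _; move: hy; rewrite -e hst hx.
- by move=> e _; move: hx; rewrite e hst hy.
Qed.

(* mu_phi; the edge is explicit because phi may stabilize several edges. *)
Definition move H phi (hphi : phi \in edge_stab H) : {perm RP} :=
  perm (@move_fun_inj H phi hphi).

Definition moves : {set {perm RP}} :=
  \bigcup_(H : 'I_k)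
     [set move (valP u) | u : {phi : {perm face k} | phi \in edge_stab H}].

Definition nonrot_rubik_group : {group {perm RP}} := <<moves>>%G.

End Rubik.

(* C_2 is 'Z_2, whose group law _ * _ (in group_scope) is addition modulo 2;  *)
(* [wreath k] is C_2 wr Sym_k.                                                *)

Section Wreath.

Variable k : nat.

Local Notation C2k := {dffun forall i : 'I_k, 'Z_2}.

(* Products in 'S_k compose left to right, so this is a right action. *)
Definition wreath_act_fun (g : C2k) (s : 'S_k) : C2k := [ffun j => g (s^-1 j)].

Lemma wreath_act_is_action : is_action [set: 'S_k] wreath_act_fun.
Proof.
split=> [s g1 g2 /ffunP e|g s t _ _].
  by apply/ffunP=> j; have := e (s j); rewrite !ffunE permK.
by apply/ffunP=> j; rewrite !ffunE invMg permM.
Qed.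

Definition wreath_action := Action wreath_act_is_action.

Lemma wreath_act_is_groupAction :
  is_groupAction [set: C2k] wreath_action.
Proof.
move=> s _; rewrite inE; apply/andP; split; first exact/subsetP.
apply/morphicP=> g1 g2 _ _; rewrite !actpermE /=.
by apply/ffunP=> j; rewrite !ffunE.
Qed.

Definition wreath_groupAction := GroupAction wreath_act_is_groupAction.

(* An element u has components u.1 : 'S_k and u.2 : C_2^k. *)
Definition wreath : finGroupType := sdprod_by wreath_groupAction.

Definition wreath_char (u : wreath) : 'Z_2 :=
  \prod_(j < k) (pair_of_sd u).2 j.

Lemma wreath_charM : {in [set: wreath] &, {morph wreath_char : u v / u * v}}.
Proof.
move=> u v _ _.
have prodE (F : 'I_k -> 'Z_2) : \prod_j F j = (\sum_j F j)%R by [].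
rewrite /wreath_char [in RHS]prodE.
rewrite (reindex_inj (@perm_inj _ ((pair_of_sd v).1^-1))) /=.
rewrite [in RHS]prodE [RHS]/= -[RHS]big_split prodE.
by apply: eq_bigr => j _; rewrite !ffunE.
Qed.

Canonical wreath_char_morphism := Morphism wreath_charM.

End Wreath.

(* Main.v *)
Require Import Defs.
From mathcomp Require Import all_boot all_order all_fingroup all_algebra.

Set Implicit Arguments.
Unset Strict Implicit.
Unset Printing Implicit Defensive.

Local Open Scope group_scope.

(* Each vertex v_i lies in two flags, (v_i, e_i) and (v_i, e_{i-1}). The reflection
   move at the edge e_H exchanges v_H and v_{H+1} and matches their flags, so the
   moves act as elements of C_2 wr Sym_k on the k pairs of flags, and this action
   of the wreath product is faithful. For a labelling of the flags that alternates
   around the polygon, the moves at e_0, ..., e_{k-2} become pure adjacent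
   transpositions; so does the last one when k is even, whereas for k odd it also
   flips both of its vertices. In the even case the moves thus generate the
   complement Sym_k, and in the odd case the conjugates of the double flip
   generate all even flip vectors, hence together with Sym_k the kernel of chi. *)

(** * Alternating labels of the flags *)

Section Labels.

Variable n : nat.
Local Notation k := n.+2.
Implicit Types (i j H : 'I_k) (b : bool).

(* The two flags at the vertex i are labelled so that the labels of (v_i, e_i)
   and (v_{i+1}, e_i) agree, except for i = k - 1 when k is odd. *)
Definition label i j : bool := odd i (+) (j != i).

(** The inverse of [label i] on the two edges through the vertex [i]. *)
Definition edge_at i b : 'I_k := if b (+) odd i then ord_pred i else i.

Lemma ordS_neq i : ordS i != i.
Proof.
apply/eqP => /(congr1 val) /=.
have [lt_ik|] := ltnP i n.+1; first by rewrite modn_small // => /eqP; rewrite eqn_leq ltnn.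
by move=> le_ki; have -> : i = ord_max; [apply/val_inj/anti_leq; rewrite -ltnS ltn_ord|rewrite /= modnn].
Qed.

Lemma ord_pred_neq i : ord_pred i != i.
Proof. by rewrite -(inj_eq (can_inj (@ordSK k))) ord_predK eq_sym ordS_neq. Qed.

Lemma vertex_edge_leE i j :
  (Vertex i <= Edge j)%O = (j == i) || (j == ord_pred i).
Proof.
rewrite [LHS]/= /Order.le /= eq_sym; congr (_ || _).
by rewrite eq_sym (can2_eq (@ordSK k) (@ord_predK k)).
Qed.

Lemma edge_at_label i j : (Vertex i <= Edge j)%O -> edge_at i (label i j) = j.
Proof.
rewrite vertex_edge_leE /edge_at /label addbAC addbb /=.
by case/orP=> /eqP->; rewrite ?eqxx ?ord_pred_neq.
Qed.

Lemma label_edge_at i b : label i (edge_at i b) = b.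
Proof.
rewrite /edge_at /label; case: b; case: (odd i) => /=; rewrite ?eqxx ?ord_pred_neq //.
Qed.

Lemma edge_at_ge i b : (Vertex i <= Edge (edge_at i b))%O.
Proof. by rewrite vertex_edge_leE /edge_at; case: ifP; rewrite eqxx ?orbT. Qed.

(** From [i] to [ordS i] the parity changes, which offsets the different position of the edge at the
    two vertices. At the wrap from k - 1 to 0 the parity changes only for k even. *)
Lemma label_ordS i : label (ordS i) i (+) label i i = odd k && (i == ord_max).
Proof.
rewrite /label eqxx [i == ordS i]eq_sym ordS_neq addbF.
have [-> | ne_im] := eqVneq i ord_max.
  by rewrite /= modnn /= andbT; case: (odd n).
rewrite andbF /= modn_small /=; first by case: (odd i).
by rewrite ltnS ltn_neqAle -ltnS ltn_ord andbT; apply: contra ne_im => /eqP e; apply/eqP/val_inj.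
Qed.

End Labels.

(** Here [1] is the neutral element of ['Z_2], the residue 0, so [!= 1] identifies C_2 with the
    booleans under xor. *)
Lemma neq1M (a b : 'Z_2) : (a * b != 1) = (a != 1) (+) (b != 1).
Proof. by case: a b => [[|[|]] // ?] [[|[|]] // ?]. Qed.

(** * The faithful action of the wreath product on R(P_k) *)

Section FlagAction.

Variable n : nat.
Local Notation k := n.+2.
Implicit Types (i j H : 'I_k) (u v : wreath k).

(** The flip is read at the target vertex, which fits the right action in the semidirect product.
    Pairs of edges stay fixed, as under every move. *)
Definition wreath_pair (x : face k * face k) u : face k * face k :=
  match x with
  | (Vertex i, Edge j) =>
    let i' := (pair_of_sd u).1 i in
    (Vertex i', Edge (edge_at i' (label i j (+) ((pair_of_sd u).2 i' != 1))))
  | (Vertex i, Vertex j) =>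
    (Vertex ((pair_of_sd u).1 i), Vertex ((pair_of_sd u).1 i))
  | _ => x
  end.

Variant RP_pred_spec : face k * face k -> Type :=
| RPVertex i : RP_pred_spec (Vertex i, Vertex i)
| RPEdge i : RP_pred_spec (Edge i, Edge i)
| RPFlag i b : RP_pred_spec (Vertex i, Edge (edge_at i b)).

Lemma RP_predP x : RP_pred x -> RP_pred_spec x.
Proof.
case: x => [[|i|i|] [|j|j|]] // Rx; case/and3P: (Rx) => [/= le_xy //= _ _].
- by move/eqP: le_xy => <-; constructor.
- by rewrite -(edge_at_label le_xy); constructor.
- by move/eqP: le_xy => <-; constructor.
Qed.

Lemma wreath_pairP (x : RP k) u : RP_pred (wreath_pair (val x) u).
Proof.
case: x => /= x /RP_predP[i|i|i b]; rewrite /RP_pred /= ?edge_at_ge //.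
  by rewrite Order.POrderTheory.lexx.
by rewrite Order.POrderTheory.lexx.
Qed.

Definition wreath_RP (x : RP k) u : RP k := Sub (wreath_pair (val x) u) (wreath_pairP x u).

Lemma wreath_RP1 x : wreath_RP x 1 = x.
Proof.
apply/val_inj; case: x => /= x /RP_predP[] //= => [i|i b].
  by rewrite perm1.
by rewrite perm1 ffunE eqxx label_edge_at addbF.
Qed.

Lemma wreath_RPM x u v : wreath_RP x (u * v) = wreath_RP (wreath_RP x u) v.
Proof.
apply/val_inj; case: x => /= x /RP_predP[] //= => [i|i b].
  by rewrite permM.
by rewrite !permM !label_edge_at !ffunE neq1M permK addbA.
Qed.

Definition flag_action := TotalAction wreath_RP1 wreath_RPM.

Lemma injm_flag_action : 'injm (actperm flag_action).
Proof.
apply/injmP=> u v _ _ /permP e.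
have {}e (x : RP k) : wreath_pair (val x) u = wreath_pair (val x) v.
  by have := congr1 val (e x); rewrite !actpermE.
have s_eq i : (pair_of_sd u).1 i = (pair_of_sd v).1 i.
  have Pi : RP_pred (Vertex i, Vertex i) by rewrite /RP_pred /= Order.POrderTheory.lexx.
  by case: (e (Sub _ Pi)).
suff: pair_of_sd u = pair_of_sd v by exact: val_inj.
case Eu: (pair_of_sd u) => [s g]; case Ev: (pair_of_sd v) => [t h].
have st: s = t by apply/permP=> i; have := s_eq i; rewrite Eu Ev.
congr (_, _); rewrite -?st //; apply/ffunP=> i.
(* A flag at [s^-1 i] lands at [i], so its new label reveals the flip component there. *)
have Pi : RP_pred (Vertex (s^-1 i), Edge (s^-1 i)).
  by rewrite /RP_pred /= vertex_edge_leE eqxx.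
have [] := e (Sub _ Pi); rewrite /= Eu Ev /= -st permKV => _.
move/(congr1 (label i)); rewrite !label_edge_at => /addbI.
by case: (g i) (h i) => [[|[|]] // ?] [[|[|]] // ?] // _; apply: val_inj.
Qed.

End FlagAction.

(** * Moves as elements of the wreath product *)

Section Moves.

Variable n : nat.
Local Notation k := n.+2.
Implicit Types (i j H : 'I_k) (phi : {perm face k}) (u : wreath k).

Lemma aut_vertex phi H i :
    phi \in edge_stab H -> (Vertex i <= Edge H)%O ->
  exists2 i', phi (Vertex i) = Vertex i' & (Vertex i' <= Edge H)%O.
Proof.
rewrite inE => /andP[phi_aut /eqP phiH] le_iH.
have := face_aut_proper (Vertex i) phi_aut.
have : (phi (Vertex i) <= phi (Edge H))%O by rewrite (face_autP _ phi_aut).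
rewrite phiH; case Ei: (phi (Vertex i)) => [|i'|j|] //= le_i' _; first by exists i'.
by move/eqP: le_i' Ei => ->; rewrite -phiH => /perm_inj.
Qed.

Lemma label_eq i j j' : (Vertex i <= Edge j)%O -> (Vertex i <= Edge j')%O ->
  (label i j == label i j') = (j == j').
Proof.
move=> le_ij le_ij'; apply/eqP/eqP => [e|-> //].
by rewrite -(edge_at_label le_ij) e edge_at_label.
Qed.

(** Only two edges meet at a vertex and [phi] fixes the edge [H], so the other edge at [i] goes to
    the other edge at [i']: its label changes exactly when that of [H] does. *)
Lemma aut_edge phi H i i' j :
    phi \in edge_stab H -> (Vertex i <= Edge H)%O -> (Vertex i <= Edge j)%O ->
    phi (Vertex i) = Vertex i' ->
  phi (Edge j) = Edge (edge_at i' (label i j (+) (label i H (+) label i' H))).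
Proof.
move=> phi_stab le_iH le_ij phi_i.
have [i1 ] := aut_vertex phi_stab le_iH; rewrite phi_i => -[<-] {i1} le_i'H.
move: phi_stab; rewrite inE => /andP[phi_aut /eqP phiH].
have [-> | ne_jH] := eqVneq j H; first by rewrite phiH addKb edge_at_label.
have := face_aut_proper (Edge j) phi_aut.
have : (phi (Vertex i) <= phi (Edge j))%O by rewrite (face_autP _ phi_aut).
case Ej: (phi (Edge j)) => [|i1|j'|] //; rewrite phi_i => le_i' _.
  by move/eqP: le_i' Ej => <-; rewrite -phi_i => /perm_inj.
have ne_j'H : j' != H.
  by apply: contraNneq ne_jH => e; move: Ej; rewrite e -phiH => /perm_inj[->].
rewrite -(edge_at_label le_i'); congr (Edge (edge_at _ _)).
move: ne_jH ne_j'H; rewrite -(label_eq le_ij) // -(label_eq le_i') //.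
by case: (label i j) (label i H) (label i' j') (label i' H) => [] [] [] [].
Qed.

(** By [aut_edge], the label change of [H] governs all flags at a vertex of [H], so only this change
    and the image of the vertex have to be compared with [u]. *)
Lemma moveE H phi (phi_stab : phi \in edge_stab H) u :
    (forall i, (Vertex i <= Edge H)%O ->
       phi (Vertex i) = Vertex ((pair_of_sd u).1 i) /\
       ((pair_of_sd u).2 ((pair_of_sd u).1 i) != 1)
         = label i H (+) label ((pair_of_sd u).1 i) H) ->
    (forall i, ~~ (Vertex i <= Edge H)%O ->
       (pair_of_sd u).1 i = i /\ (pair_of_sd u).2 i = 1) ->
  move phi_stab = actperm (flag_action n) u.
Proof.
move=> u_in u_out; apply/permP=> x; apply/val_inj; rewrite permE actpermE /=.
have phiH : phi (Edge H) = Edge H by move: phi_stab; rewrite inE => /andP[_ /eqP].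
rewrite /move_pair; case: x => /= x /RP_predP[i|i|i b] /=.
- case: ifPn => [/u_in[-> _] //|/u_out[-> _] //].
- by case: ifPn => // /eqP->; rewrite phiH.
- case: ifPn => [le_iH | /u_out[-> ->]]; last by rewrite eqxx label_edge_at addbF.
  have [phi_i ->] := u_in _ le_iH.
  by rewrite phi_i (aut_edge phi_stab le_iH (edge_at_ge i b) phi_i).
Qed.

Definition flip i : {dffun forall i : 'I_k, 'Z_2} :=
  [ffun j => if j == i then Zp1 else 1].

Lemma wreath_subproof (s : 'S_k) (g : {dffun forall i : 'I_k, 'Z_2}) :
  (s, g) \in setX [set: 'S_k] [set: {dffun forall i : 'I_k, 'Z_2}].
Proof. by rewrite !inE. Qed.

Definition wreath_of s g : wreath k := SdPair (wreath_groupAction k) (wreath_subproof s g).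

(** The flips account for the defect in [label_ordS]. *)
Definition turn H : wreath k :=
  wreath_of (tperm H (ordS H))
    (if odd k && (H == ord_max) then flip H * flip (ordS H) else 1).

(** An automorphism fixing an edge permutes its two vertices: it either fixes both, and then also
    their flags, or swaps them. *)
Lemma move_turn H phi (phi_stab : phi \in edge_stab H) :
  move phi_stab =
    actperm (flag_action n) (if phi (Vertex H) == Vertex H then 1 else turn H).
Proof.
have leP i : (Vertex i <= Edge H)%O = (i == H) || (i == ordS H) by [].
have [|i0 phi0] := @aut_vertex _ _ H phi_stab; first by rewrite leP eqxx.
have [|i1 phi1] := @aut_vertex _ _ (ordS H) phi_stab; first by rewrite leP eqxx orbT.
rewrite !leP => i1P i0P.
have ne_i : i0 != i1.
  apply: contraNneq (ordS_neq H) => e.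
  by move: phi0; rewrite e -phi1 => /perm_inj[<-].
apply: moveE => i; rewrite leP.
- case: ifPn => [|].
    rewrite phi0 => /eqP[e0] le_i; rewrite /= perm1 ffunE eqxx addbb; split=> //.
    move: i1P; rewrite eq_sym -{1}e0 eq_sym [i1 == i0]eq_sym (negPf ne_i) /= => /eqP e1.
    by case/orP: le_i => /eqP->; rewrite ?phi0 ?phi1 ?e0 ?e1.
  rewrite phi0 => ne_i0H.
  have {}i0P : i0 = ordS H.
    by case/orP: i0P ne_i0H => /eqP-> //; rewrite eqxx.
  have {}i1P : i1 = H.
    by case/orP: i1P ne_i => /eqP-> //; rewrite i0P eqxx.
  have lab := label_ordS H.
  case/orP=> /eqP->; rewrite /= ?tpermL ?tpermR ?phi0 ?phi1 ?i0P ?i1P; split=> //.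
    rewrite [RHS]addbC lab; case: ifP => _; rewrite !ffunE ?eqxx //.
    by rewrite (negPf (ordS_neq H)).
  rewrite lab; case: ifP => _; rewrite !ffunE ?eqxx //.
  by rewrite [H == _]eq_sym (negPf (ordS_neq H)).
- rewrite negb_or => /andP[ne1 ne2]; case: ifP => _; rewrite /= ?perm1 ?ffunE //.
  rewrite tpermD 1?eq_sym //; split=> //.
  by case: ifP => _; rewrite !ffunE ?(negPf ne1) ?(negPf ne2) ?mulg1.
Qed.

Lemma ordSE i : ordS i = (i + 1)%R.
Proof. by apply/val_inj; rewrite /= modnDmr addn1. Qed.

(** The reflection of the polygon through the edge [H], with indices in Z/k. The endpoints j and j +
    1 of an edge go to those of its image in reverse order. *)
Definition refl_face H (F : face k) : face k :=
  match F with
  | Vertex i => Vertex (H + (H + 1) - i)%R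
  | Edge j => Edge (H + H - j)%R
  | _ => F
  end.

Lemma refl_faceK H : involutive (refl_face H).
Proof. by case=> //= i; rewrite GRing.subKr. Qed.

Lemma refl_face_stab H : perm (can_inj (refl_faceK H)) \in edge_stab H.
Proof.
rewrite inE permE /= GRing.addrK eqxx andbT.
apply/face_autP => F G; rewrite !permE.
have inj a : injective (fun i : 'I_k => a - i)%R by move=> i j /GRing.addrI/GRing.oppr_inj.
case: F G => [|i|i|] [|j|j|] //.
- exact: (inj_eq (inj _)).
- rewrite /Order.le /= orbC !ordSE.
  have -> : (H + H - j + 1 = H + (H + 1) - j)%R by rewrite !GRing.addrA [LHS]GRing.addrAC.
  have -> : (H + H - j = H + (H + 1) - (j + 1))%R.
    by rewrite GRing.addrA [(j + 1)%R]GRing.addrC GRing.addrKA.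
  by rewrite !(inj_eq (inj _)).
- exact: (inj_eq (inj _)).
Qed.

Lemma refl_face_vertex H : perm (can_inj (refl_faceK H)) (Vertex H) != Vertex H.
Proof.
rewrite permE /= GRing.addrC GRing.addKr -ordSE.
by apply: contra (ordS_neq H) => /eqP[e]; apply/eqP.
Qed.

(** Every move is trivial or a turn by [move_turn], and the reflections [refl_face] realise all
    turns. *)
Lemma rubik_turns :
  nonrot_rubik_group k = (actperm (flag_action n) @* <<[set turn H | H : 'I_k]>>)%G.
Proof.
apply/val_inj; rewrite /= morphim_gen ?subsetT //.
apply/eqP; rewrite eqEsubset !gen_subG; apply/andP; split; apply/subsetP=> x.
  case/bigcupP=> H _ /imsetP[phi _ ->]; rewrite move_turn.
  case: ifP => _; first by rewrite morph1 group1.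
  by rewrite mem_gen // mem_morphim ?inE // imset_f.
case/morphimP=> _ _ /imsetP[H _ ->] ->; apply: mem_gen; apply/bigcupP; exists H => //.
apply/imsetP; exists (exist (fun phi => phi \in edge_stab H) _ (refl_face_stab H)) => //.
by rewrite move_turn /= (negPf (refl_face_vertex H)).
Qed.

End Moves.

(** The transpositions (0 i) generate, and (0 i+1) is the conjugate of (0 i) by (i i+1). The
    wrap-around transposition is left out because the last turn may carry flips. *)
Lemma gen_adjacent_tperm n :
  <<[set tperm i (ordS i) | i : 'I_n.+1 & i != ord_max]>> = [set: 'S_n.+1].
Proof.
apply/eqP; rewrite eqEsubset subsetT -(gen_tperm ord0) gen_subG /=.
apply/subsetP=> _ /imsetP[[i lt_in] _ ->]; elim: i lt_in => [|i IHi] lt_in.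
  by rewrite [Ordinal _](_ : _ = ord0) ?tperm1 ?group1 //; apply: val_inj.
have lt_i : i < n.+1 by exact: ltnW.
set j := Ordinal lt_in; set j' := Ordinal lt_i.
have S_j' : ordS j' = j by apply: val_inj; rewrite /= modn_small.
have adj : tperm j' j \in <<[set tperm i (ordS i) | i : 'I_n.+1 & i != ord_max]>>.
  apply: mem_gen; apply/imsetP; exists j'; rewrite ?S_j' //.
  by rewrite inE -(inj_eq val_inj) /= neq_ltn -ltnS lt_in.
have [j'0|j'_neq0] := eqVneq j' ord0; first by rewrite -[ord0]j'0.
rewrite [tperm _ _](_ : _ = tperm ord0 j' ^ tperm j' j); first by rewrite groupJ ?IHi.
by rewrite tpermJ tpermL tpermD // eq_sym.
Qed.

(** * The subgroup generated by the turns *)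

Section WreathGeneration.

Variable n : nat.
Local Notation k := n.+2.
Local Notation C2k := {dffun forall i : 'I_k, 'Z_2}.
Implicit Types (i j H : 'I_k) (s : 'S_k) (g : C2k).

Lemma sdpair1E g : sdpair1 (wreath_groupAction k) g = wreath_of 1 g.
Proof. by apply/val_inj; rewrite insubdK // !inE. Qed.

Lemma sdpair2E s : sdpair2 (wreath_groupAction k) s = wreath_of s 1.
Proof. by apply/val_inj; rewrite insubdK // !inE. Qed.

Lemma turnE H : turn H =
  sdpair2 _ (tperm H (ordS H)) *
  sdpair1 (wreath_groupAction k)
    (if odd k && (H == ord_max) then flip H * flip (ordS H) else 1).
Proof. by rewrite [LHS]sdpairE. Qed.

Lemma perms_sub_turns :
  sdpair2 (wreath_groupAction k) @* setT \subset <<[set turn H | H : 'I_k]>>.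
Proof.
rewrite -gen_adjacent_tperm morphim_gen ?subsetT // gen_subG.
apply/subsetP=> _ /morphimP[s _ /imsetP[H neH ->] ->].
apply/mem_gen/imsetP; exists H => //.
by move: neH; rewrite inE turnE => /negPf->; rewrite andbF morph1 mulg1.
Qed.

Lemma turns_even : ~~ odd k ->
  <<[set turn H | H : 'I_k]>> = sdpair2 (wreath_groupAction k) @* setT.
Proof.
move=> even_k; apply/eqP; rewrite eqEsubset perms_sub_turns andbT gen_subG.
apply/subsetP=> _ /imsetP[H _ ->].
by rewrite turnE (negPf even_k) morph1 mulg1 mem_morphim ?inE.
Qed.

Lemma wreath_char_sdpair1 g :
  wreath_char (sdpair1 (wreath_groupAction k) g) = (\sum_j g j)%R.
Proof. by rewrite sdpair1E. Qed.

Lemma wreath_char_sdpair2 s : wreath_char (sdpair2 (wreath_groupAction k) s) = 1.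
Proof. by rewrite sdpair2E /wreath_char big1 // => j _; rewrite ffunE. Qed.

Lemma flipE i j : flip i j = (j == i)%:R%R.
Proof. by rewrite ffunE; case: eqP. Qed.

Lemma sum_flip i : (\sum_j flip i j)%R = 1%R.
Proof.
rewrite (bigD1 i) //= flipE eqxx big1 ?GRing.addr0 // => j /negPf ne.
by rewrite flipE ne.
Qed.

Lemma wreath_char_flips i j :
  wreath_char (sdpair1 (wreath_groupAction k) (flip i * flip j)) = 1.
Proof.
rewrite wreath_char_sdpair1.
transitivity (\sum_l (flip i l + flip j l))%R; first by apply: eq_bigr => l _; rewrite ffunE.
by rewrite big_split !sum_flip; apply: val_inj.
Qed.

Lemma wreath_act_flip i s : wreath_groupAction k (flip i) s = flip (s i).
Proof.
by apply/ffunP=> j; rewrite !ffunE (can2_eq (permKV s) (permK s)).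
Qed.

(* The spurious factors flip ord0 occur an even number of times in total. *)
Lemma flipsE g : (\sum_j g j)%R = 0%R -> g = \prod_(j | g j != 1) (flip j * flip ord0).
Proof.
move=> sum_g; apply/ffunP=> i.
have evalM : {morph (fun h : C2k => h i) : h h' / h * h' >-> (h + h')%R}.
  by move=> h h'; rewrite ffunE.
rewrite (big_morph _ evalM (ffunE _ _)).
rewrite [RHS](eq_bigr (fun j => g j * (flip j i + flip ord0 i)))%R; last first.
  move=> j gj; rewrite evalM [g j](_ : _ = 1)%R ?GRing.mul1r //.
  by apply/val_inj; case: (g j) gj => [[|[|]]].
rewrite big_mkcond (eq_bigr (fun j => g j * flip j i + g j * flip ord0 i))%R; last first.
  move=> j _; rewrite -GRing.mulrDr; case: eqP => //= ->.
  by rewrite GRing.mul0r.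
rewrite big_split /= -GRing.mulr_suml sum_g GRing.mul0r GRing.addr0 /=.
rewrite (bigD1 i) //= flipE eqxx GRing.mulr1 big1 ?GRing.addr0 // => j ne_ji.
by rewrite flipE eq_sym (negPf ne_ji) GRing.mulr0.
Qed.

(** Removing the transposition from the last turn leaves a double flip, which conjugation by
    permutations carries to any pair of distinct vertices. *)
Lemma flips_in_turns i j : odd k ->
  sdpair1 (wreath_groupAction k) (flip i * flip j) \in <<[set turn H | H : 'I_k]>>.
Proof.
move=> odd_k.
have perm_in s : sdpair2 (wreath_groupAction k) s \in <<[set turn H | H : 'I_k]>>.
  by rewrite (subsetP perms_sub_turns) // mem_morphim ?inE.
have [->|ne_ij] := eqVneq i j.
  rewrite [_ * _](_ : _ = 1) ?morph1 ?group1 //.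
  by apply/ffunP=> l; rewrite !ffunE; case: eqP => _; apply: val_inj.
have max_in : sdpair1 (wreath_groupAction k) (flip ord_max * flip (ordS ord_max))
    \in <<[set turn H | H : 'I_k]>>.
  have : turn ord_max \in <<[set turn H | H : 'I_k]>> by rewrite mem_gen ?imset_f.
  by rewrite turnE odd_k eqxx groupMl.
have [s s_i s_j] : exists2 s : 'S_k, s ord_max = i & s (ordS ord_max) = j.
  (* After the first transposition has put [ord_max] in place, the second sends [m] to [j] and
     leaves [i] alone, as [i] differs from both. *)
  pose m := tperm ord_max i (ordS ord_max); exists (tperm ord_max i * tperm m j).
    rewrite permM tpermL tpermD 1?eq_sym //.
    by rewrite -[X in X != _](tpermL ord_max i) (inj_eq perm_inj) eq_sym ordS_neq.
  by rewrite permM tpermL.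
have := groupJ max_in (perm_in s).
rewrite -sdpair_act ?inE // gactM ?inE //.
by rewrite !wreath_act_flip s_i s_j.
Qed.

Lemma turns_odd : odd k ->
  <<[set turn H | H : 'I_k]>> = 'ker (@wreath_char k).
Proof.
move=> odd_k; apply/eqP; rewrite eqEsubset gen_subG; apply/andP; split.
  apply/subsetP=> _ /imsetP[H _ ->]; apply/kerP; rewrite ?inE //.
  rewrite turnE morphM ?inE //= wreath_char_sdpair2 mul1g.
  by case: ifP => _; rewrite ?wreath_char_flips // morph1 morph1.
apply/subsetP=> u /mker; rewrite [u]sdpairE morphM ?inE //=.
(* The character sees only the flip part of [u], which is thus an even vector and a product of
   double flips. *)
rewrite wreath_char_sdpair2 mul1g wreath_char_sdpair1 => /flipsE ->.
rewrite groupM //; first by rewrite (subsetP perms_sub_turns) // mem_morphim ?inE.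
rewrite morph_prod; last by move=> i _; rewrite inE.
by apply: group_prod => i _; apply: flips_in_turns.
Qed.

End WreathGeneration.

Theorem proposition3p3 (k : nat) (hk : (2 <= k)%N) :
  (~~ odd k -> nonrot_rubik_group k \isog [set: 'S_k]) /\
  (odd k -> nonrot_rubik_group k \isog 'ker (@wreath_char k)).
Proof.
case: k hk => [|[|n]] // _; rewrite rubik_turns.
split=> [even_k | odd_k]; rewrite isog_sym /=.
  rewrite turns_even //.
  apply: isog_trans (sub_isog (subsetT _) (injm_flag_action n)).
  exact: sub_isog (subxx _) (injm_sdpair2 (wreath_groupAction n.+2)).
by rewrite -turns_odd //; apply: sub_isog (subsetT _) (injm_flag_action n).
Qed.
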